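(* Let $(\mathfrak{A},\mathfrak{B},\iota,\mathfrak{S})$ be a spectral duality, let $i_*:\mathfrak{B}_*\hookrightarrow\mathfrak{B}$ be the inclusion of the fiber over the one-point space $*$, and let $\Gamma:\mathfrak{A}\to\mathfrak{B}_*$ be the associated global sections functor. Then there is an adjunction $\mathfrak{S}\circ i_*\dashv\Gamma$.
   Context: **Fibered categories of spatial objects.** All categories are over $\mathcal{T}op^{op}$: for $\mathfrak{B}\to\mathcal{T}op^{op}$ write $|\mathbb{B}|$ for the underlying space of an object; an arrow $h:\mathbb{B}\to\mathbb{C}$ of $\mathfrak{B}$ lies over a continuous map $|h|:|\mathbb{C}|\to|\mathbb{B}|$ (reversed direction). *Fibration (inverse image lifts)*: for every $\mathbb{B}$ and continuous $f:X\to|\mathbb{B}|$ there is an arrow $\overline f:\mathbb{B}\to f^*\mathbb{B}$ over $f$ such that for each $h:\mathbb{B}\to\mathbb{C}$ and each continuous $g:|\mathbb{C}|\to X$ with $f\circ g=|h|$ there is a unique $k:f^*\mathbb{B}\to\mathbb{C}$ over $g$ with $k\circ\overline f=h$. *Opfibration (direct image lifts)*: for every $\mathbb{C}$ and continuous $f:|\mathbb{C}|\to Y$ there is an arrow $\overline f:f_*\mathbb{C}\to\mathbb{C}$ over $f$ such that for each $h:\mathbb{B}\to\mathbb{C}$ and each continuous $g:Y\to|\mathbb{B}|$ with $g\circ f=|h|$ there is a unique $k:\mathbb{B}\to f_*\mathbb{C}$ over $g$ with $\overline f\circ k=h$. **Spectral duality.** A quadruple $(\mathfrak{A},\mathfrak{B},\iota,\mathfrak{S})$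 where $\mathfrak{A}$ and $\mathfrak{B}$ are fibrations over $\mathcal{T}op^{op}$ (every object has inverse image lifts along every continuous map into its underlying space), $\mathfrak{B}$ is moreover an opfibration over $\mathcal{T}op^{op}$ (every object has direct image lifts along every continuous map out of its underlying space), $\iota:\mathfrak{A}\to\mathfrak{B}$ is a strict morphism of fibrations (it commutes strictly with the projections to $\mathcal{T}op^{op}$ and preserves inverse image lifts), and $\mathfrak{S}:\mathfrak{B}\to\mathfrak{A}$ is left adjoint to $\iota$, $\mathfrak{S}\dashv\iota$ (with no requirement that $\mathfrak{S}$ commute with the projections). For $\mathbb{A}$ in $\mathfrak{A}$, $|\mathbb{A}|=|\iota\mathbb{A}|$. **Global sections.** $\mathfrak{B}_*$ is the fiber over $*$ (objects over $*$ and arrows over $1_*$). $\Gamma$ sends $\mathbb{A}$ to $(!_{|\mathbb{A}|})_*\iota(\mathbb{A})$, the direct image along the unique map $!_{|\mathbb{A}|}:|\mathbb{A}|\to *$, and sends $h:\mathbb{A}_1\to\mathbb{A}_2$ to the arrow $\Gamma\mathbb{A}_1\to\Gamma\mathbb{A}_2$ over $1_*$ induced by the universal property of the direct image lift $\Gamma\mathbb{A}_2\to\iota\mathbb{A}_2$ from the composite $\Gamma\mathbb{A}_1\to\iota\mathbb{A}_1\to\iota\mathbb{A}_2$. *)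

(* Defs.v *)
From HB Require Import structures.
From mathcomp Require Import all_boot all_classical.
From mathcomp Require Import topology.

Set Implicit Arguments.
Unset Strict Implicit.
Unset Printing Implicit Defensive.

Record category := Category {
  obj :> Type;
  hom : obj -> obj -> Type;
  idm : forall a, hom a a;
  comp : forall a b c, hom b c -> hom a b -> hom a c;
  comp_idl : forall a b (h : hom a b), comp (idm b) h = h;
  comp_idr : forall a b (h : hom a b), comp h (idm a) = h;
  compA : forall a b c d (h : hom c d) (g : hom b c) (f : hom a b),
    comp h (comp g f) = comp (comp h g) f }.

Arguments idm {_} a.

Declare Scope cat_scope.
Local Open Scope cat_scope.
Notation "a ~> b" := (hom a b) (at level 90, b at level 90) : cat_scope.
Notation "g ** f" := (comp g f) (at level 40, left associativity) : cat_scope.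

Definition opposite (C : category) : category :=
  @Category C (fun a b => b ~> a) (fun a => idm a) (fun a b c g f => f ** g)
    (fun a b h => comp_idr h) (fun a b h => comp_idl h)
    (fun a b c d h g f => esym (compA f g h)).

Record functor (C D : category) := Functor {
  fobj :> C -> D;
  fmap : forall a b, (a ~> b) -> (fobj a ~> fobj b);
  fmap_id : forall a, fmap (idm a) = idm (fobj a);
  fmap_comp : forall a b c (g : b ~> c) (f : a ~> b),
    fmap (g ** f) = fmap g ** fmap f }.

Lemma functor_comp_id (C D E : category) (G : functor D E) (F : functor C D) a :
  fmap G (fmap F (idm a)) = idm (G (F a)).
Proof. by rewrite !fmap_id. Qed.

Lemma functor_comp_comp (C D E : category) (G : functor D E) (F : functor C D)
    a b c (g : b ~> c) (f : a ~> b) :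
  fmap G (fmap F (g ** f)) = fmap G (fmap F g) ** fmap G (fmap F f).
Proof. by rewrite !fmap_comp. Qed.

Definition functor_comp (C D E : category) (G : functor D E) (F : functor C D) :
    functor C E :=
  @Functor C E (fun a => G (F a)) (fun a b h => fmap G (fmap F h))
    (functor_comp_id G F) (@functor_comp_comp _ _ _ G F).

(* The data of an adjunction with left adjoint [F] and right adjoint [G]. *)
Record adjunction (C D : category) (F : functor C D) (G : functor D C) :=
  Adjunction {
  transpose : forall c d, (F c ~> d) -> (c ~> G d);
  untranspose : forall c d, (c ~> G d) -> (F c ~> d);
  transposeK : forall c d, cancel (@transpose c d) (@untranspose c d);
  untransposeK : forall c d, cancel (@untranspose c d) (@transpose c d);
  transpose_natural : forall c c' d d' (u : c' ~> c) (v : d ~> d')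
      (h : F c ~> d),
    transpose (v ** h ** fmap F u) = fmap G v ** transpose h ** u }.

Definition ccomp (X Y Z : topologicalType) (g : continuousType Y Z)
  (f : continuousType X Y) : continuousType X Z := g \o f.

Definition cid_map (X : topologicalType) : continuousType X X := idfun.

Lemma ccomp_idl (X Y : topologicalType) (f : continuousType X Y) :
  ccomp (cid_map Y) f = f.
Proof. exact/continuousEP. Qed.

Lemma ccomp_idr (X Y : topologicalType) (f : continuousType X Y) :
  ccomp f (cid_map X) = f.
Proof. exact/continuousEP. Qed.

Lemma ccompA (X Y Z T : topologicalType) (h : continuousType Z T)
    (g : continuousType Y Z) (f : continuousType X Y) :
  ccomp h (ccomp g f) = ccomp (ccomp h g) f.
Proof. exact/continuousEP. Qed.

Definition Top : category :=
  @Category topologicalType (fun X Y => continuousType X Y) cid_map ccomp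
    ccomp_idl ccomp_idr ccompA.

Definition point_type := unit.
HB.instance Definition _ := Choice.on point_type.
HB.instance Definition _ := hasNbhs.Build point_type principal_filter.
HB.instance Definition _ := Discrete_ofNbhs.Build point_type erefl.
Definition one_point : topologicalType := point_type.

Definition to_point (X : topologicalType) : continuousType X one_point :=
  cst tt.

Lemma to_point_unique (X : topologicalType) (f g : continuousType X one_point) :
  f = g.
Proof. by apply/continuousEP => x; case: (f x) (g x) => -[]. Qed.

(* A functor [P : functor B (opposite Top)] sends an object [b] to its
   underlying space [P b] and an arrow [h : b ~> c] to a continuous map
   [fmap P h] from [P c] to [P b]. *)

(* [over P h f] says that [h] lies over [f]. As in the usual definition, this
   includes that the underlying spaces of the endpoints of [h] are equal to the
   given spaces [X] and [Y]; the inductive family expresses the equality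
   [fmap P h = f] between maps whose types agree only up to these equalities. *)
Inductive over (B : category) (P : functor B (opposite Top)) (b c : B)
    (h : b ~> c) : forall X Y : topologicalType, continuousType Y X -> Prop :=
  Over : @over B P b c h (P b) (P c) (fmap P h).

Arguments over {B} P {b c} h {X Y} f.

Section Lifts.
Variables (B : category) (P : functor B (opposite Top)).

Definition is_inverse_image_lift (b : B) (X : topologicalType)
    (f : continuousType X (P b)) (b' : B) (fbar : b ~> b') : Prop :=
  over P fbar f /\
  forall (c : B) (h : b ~> c) (g : continuousType (P c) X),
    ccomp f g = fmap P h ->
    exists! k : b' ~> c, over P k g /\ k ** fbar = h.

Definition is_direct_image_lift (c : B) (Y : topologicalType)
    (f : continuousType (P c) Y) (c' : B) (fbar : c' ~> c) : Prop :=
  over P fbar f /\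
  forall (b : B) (h : b ~> c) (g : continuousType Y (P b)),
    ccomp g f = fmap P h ->
    exists! k : b ~> c', over P k g /\ fbar ** k = h.

Record inverse_image_lift (b : B) (X : topologicalType)
    (f : continuousType X (P b)) := InverseImageLift {
  inv_obj : B;
  inv_arr : b ~> inv_obj;
  inv_lift : is_inverse_image_lift f inv_arr }.

Record direct_image_lift (c : B) (Y : topologicalType)
    (f : continuousType (P c) Y) := DirectImageLift {
  dir_obj : B;
  dir_arr : dir_obj ~> c;
  dir_lift : is_direct_image_lift f dir_arr }.

(* Fibrations and opfibrations come with a chosen lift for each map; given mere
   existence, such choices are provided by the axiom of choice. *)
Definition fibration := forall (b : B) (X : topologicalType)
  (f : continuousType X (P b)), inverse_image_lift f.

Definition opfibration := forall (c : B) (Y : topologicalType)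
  (f : continuousType (P c) Y), direct_image_lift f.

Lemma over_inv (b c : B) (h : b ~> c) (X Y : topologicalType)
    (f : continuousType Y X) :
  over P h f -> exists (ec : P c = Y) (eb : P b = X),
    f = ecast Y (continuousType Y X) ec
          (ecast X (continuousType (P c) X) eb (fmap P h)).
Proof. by case; exists erefl, erefl. Qed.

Lemma over_dom (b c : B) (h : b ~> c) (X Y : topologicalType)
  (f : continuousType Y X) : over P h f -> P b = X.
Proof. by case. Qed.

Lemma over_idm (b : B) (X : topologicalType) :
  P b = X -> over P (idm b) (cid_map X).
Proof. by case: X /; have := Over P (idm b); rewrite fmap_id. Qed.

Lemma over_comp (b c d : B) (k : c ~> d) (h : b ~> c)
    (X Y Z : topologicalType) (f : continuousType Y X)
    (g : continuousType Z Y) :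
  over P h f -> over P k g -> over P (k ** h) (ccomp f g).
Proof.
move=> oh ok; case: ok f oh => f /over_inv[ec [eb ->]].
rewrite (Prop_irrelevance ec erefl) /=; case: X / eb f => f /=.
by have := Over P (k ** h); rewrite fmap_comp.
Qed.

Lemma direct_image_lift_over (c : B) (Y : topologicalType)
    (f : continuousType (P c) Y) (c' : B) (fbar : c' ~> c) (b : B)
    (h : b ~> c) (X : topologicalType) (g : continuousType Y X) :
  is_direct_image_lift f fbar -> over P h (ccomp g f) ->
  exists! k : b ~> c', over P k g /\ fbar ** k = h.
Proof.
move=> [_ lift] oh; have eb := over_dom oh; case: X / eb g oh => g oh.
apply: lift; have [ec [eb ->]] := over_inv oh.
by rewrite (Prop_irrelevance ec erefl) (Prop_irrelevance eb erefl).
Qed.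

End Lifts.

Section Fiber.
Variables (B : category) (P : functor B (opposite Top)) (X : topologicalType).

Definition fiber_obj := {b : B | P b = X}.

Definition fiber_hom (b c : fiber_obj) :=
  {h : sval b ~> sval c | over P h (cid_map X)}.

Definition fiber_idm (b : fiber_obj) : fiber_hom b b :=
  exist _ (idm (sval b)) (over_idm (svalP b)).

Lemma fiber_comp_over (b c d : fiber_obj) (k : fiber_hom c d)
    (h : fiber_hom b c) :
  over P (sval k ** sval h) (cid_map X).
Proof. by have := over_comp (svalP h) (svalP k); rewrite ccomp_idl. Qed.

Definition fiber_comp (b c d : fiber_obj) (k : fiber_hom c d)
  (h : fiber_hom b c) : fiber_hom b d := exist _ _ (fiber_comp_over k h).

Lemma fiber_hom_eq (b c : fiber_obj) (h k : fiber_hom b c) :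
  sval h = sval k -> h = k.
Proof. exact: eq_sig_hprop => ? ? ?; exact: Prop_irrelevance. Qed.

Lemma fiber_idl (b c : fiber_obj) (h : fiber_hom b c) :
  fiber_comp (fiber_idm c) h = h.
Proof. by apply: fiber_hom_eq; rewrite /= comp_idl. Qed.

Lemma fiber_idr (b c : fiber_obj) (h : fiber_hom b c) :
  fiber_comp h (fiber_idm b) = h.
Proof. by apply: fiber_hom_eq; rewrite /= comp_idr. Qed.

Lemma fiber_compA (a b c d : fiber_obj) (h : fiber_hom c d)
    (g : fiber_hom b c) (f : fiber_hom a b) :
  fiber_comp h (fiber_comp g f) = fiber_comp (fiber_comp h g) f.
Proof. by apply: fiber_hom_eq; rewrite /= compA. Qed.

Definition fiber : category :=
  @Category fiber_obj fiber_hom fiber_idm fiber_comp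
    fiber_idl fiber_idr fiber_compA.

Definition fiber_inclusion : functor fiber B :=
  @Functor fiber B (fun b => sval b) (fun a b h => sval h)
    (fun=> erefl) (fun _ _ _ _ _ => erefl).

End Fiber.

Record spectral_duality := SpectralDuality {
  sdA : category;
  sdB : category;
  spA : functor sdA (opposite Top);
  spB : functor sdB (opposite Top);
  sdA_fibration : fibration spA;
  sdB_fibration : fibration spB;
  sdB_opfibration : opfibration spB;
  iota : functor sdA sdB;
  iota_strict : functor_comp spB iota = spA;
  (* An arrow [h] that is a lift of some [f] is a lift of [fmap spA h], so this
     covers all inverse image lifts. *)
  iota_inverse_image : forall (a a' : sdA) (h : a ~> a'),
    is_inverse_image_lift (P := spA) (fmap spA h) h ->
    is_inverse_image_lift (P := spB) (fmap spB (fmap iota h)) (fmap iota h);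
  Spec : functor sdB sdA;
  Spec_adj : adjunction Spec iota }.

Section GlobalSections.
Variable D : spectral_duality.
Let B := sdB D.
Let P : functor B (opposite Top) := spB D.

Definition gs_lift (a : sdA D) : direct_image_lift (to_point (P (iota D a))) :=
  sdB_opfibration (to_point (P (iota D a))).

Lemma gs_over (a : sdA D) : P (dir_obj (gs_lift a)) = one_point.
Proof. exact: over_dom (dir_lift (gs_lift a)).1. Qed.

Definition gs_obj (a : sdA D) : fiber P one_point :=
  exist _ (dir_obj (gs_lift a)) (gs_over a).

Lemma gs_hom_exists (a1 a2 : sdA D) (h : a1 ~> a2) :
  exists! k : dir_obj (gs_lift a1) ~> dir_obj (gs_lift a2),
    over P k (cid_map one_point) /\
    dir_arr (gs_lift a2) ** k = fmap (iota D) h ** dir_arr (gs_lift a1).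
Proof.
apply: direct_image_lift_over (dir_lift (gs_lift a2)) _.
rewrite (to_point_unique (ccomp _ _)
  (ccomp (to_point (P (iota D a1))) (fmap P (fmap (iota D) h)))).
exact: over_comp (dir_lift (gs_lift a1)).1 (Over P _).
Qed.

Definition gs_fmap (a1 a2 : sdA D) (h : a1 ~> a2) : gs_obj a1 ~> gs_obj a2 :=
  let: exist k p := cid (gs_hom_exists h) in exist _ k p.1.1.

Lemma gs_fmapE (a1 a2 : sdA D) (h : a1 ~> a2) :
  dir_arr (gs_lift a2) ** sval (gs_fmap h) =
  fmap (iota D) h ** dir_arr (gs_lift a1).
Proof. by rewrite /gs_fmap; case: cid => k [[]]. Qed.

Lemma gs_fmap_unique (a1 a2 : sdA D) (h : a1 ~> a2)
    (k : gs_obj a1 ~> gs_obj a2) :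
  dir_arr (gs_lift a2) ** sval k = fmap (iota D) h ** dir_arr (gs_lift a1) ->
  gs_fmap h = k.
Proof.
move=> kE; apply: fiber_hom_eq.
have [k0 [_ k0U]] := gs_hom_exists h.
have <- : k0 = sval (gs_fmap h).
  by apply: k0U; split; [exact: (proj2_sig (gs_fmap h))|exact: gs_fmapE].
by apply: k0U; split; [exact: (proj2_sig k)|].
Qed.

Lemma gs_fmap_id (a : sdA D) : gs_fmap (idm a) = idm (gs_obj a).
Proof. by apply: gs_fmap_unique; rewrite /= fmap_id comp_idl comp_idr. Qed.

Lemma gs_fmap_comp (a b c : sdA D) (g : b ~> c) (f : a ~> b) :
  gs_fmap (g ** f) = gs_fmap g ** gs_fmap f.
Proof.
apply: gs_fmap_unique.
by rewrite /= compA gs_fmapE -compA gs_fmapE compA fmap_comp.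
Qed.

Definition global_sections : functor (sdA D) (fiber P one_point) :=
  Functor gs_fmap_id gs_fmap_comp.

End GlobalSections.

(* Main.v *)
From mathcomp Require Import all_boot all_classical.
From mathcomp Require Import topology.
Require Import Defs.

Set Implicit Arguments.
Unset Strict Implicit.
Unset Printing Implicit Defensive.
Local Open Scope cat_scope.

(** The point being terminal in spaces, every arrow [b ~> iota a] with [b] over
    the point lies over [|a| -> *], hence factors uniquely through the direct
    image lift [Gamma a ~> iota a] by an arrow over the identity of the point.
    Composing this bijection with that of [Spec -| iota] gives the adjunction. *)

(** Maps into the point are unique; the only care needed is that [P b] equals [one_point] merely
    propositionally. *)
Lemma over_to_point (B : category) (P : functor B (opposite Top)) (b c : B)
    (h : b ~> c) :
  P b = one_point -> over P h (to_point (P c)).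
Proof.
(* Once [fmap P h] is a variable, its codomain [P b] can be rewritten to the point. *)
have := Over P h; move: (fmap P h : continuousType (P c) (P b)).
by move=> f oh eb; move: f oh; rewrite eb => f; rewrite (to_point_unique f (to_point _)).
Qed.

Section GlobalSectionsFactorization.
Variable D : spectral_duality.
Let P : functor (sdB D) (opposite Top) := spB D.

Lemma gs_factor_exists (b : fiber P one_point) (a : sdA D)
    (h : sval b ~> iota D a) :
  exists! k : sval b ~> dir_obj (gs_lift a),
    over P k (cid_map one_point) /\ dir_arr (gs_lift a) ** k = h.
Proof.
apply: direct_image_lift_over (dir_lift (gs_lift a)) _.
by rewrite ccomp_idl; exact: over_to_point (svalP b).
Qed.

Definition gs_factor (b : fiber P one_point) (a : sdA D)
    (h : sval b ~> iota D a) : b ~> gs_obj a :=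
  let: exist k p := cid (gs_factor_exists h) in exist _ k p.1.1.

Lemma gs_factorE (b : fiber P one_point) (a : sdA D) (h : sval b ~> iota D a) :
  dir_arr (gs_lift a) ** sval (gs_factor h) = h.
Proof. by rewrite /gs_factor; case: cid => k [[]]. Qed.

(** Reduces equations in the fiber to equations in [sdB D], used below for one inverse law and for
    naturality. *)
Lemma gs_factor_unique (b : fiber P one_point) (a : sdA D)
    (h : sval b ~> iota D a) (k : b ~> gs_obj a) :
  dir_arr (gs_lift a) ** sval k = h -> gs_factor h = k.
Proof.
move=> kE; apply: fiber_hom_eq; have [k0 [_ k0U]] := gs_factor_exists h.
transitivity k0; last by apply: k0U; split; [exact: (proj2_sig k)|].
by symmetry; apply: k0U; split; [exact: (proj2_sig (gs_factor h))|exact: gs_factorE].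
Qed.

End GlobalSectionsFactorization.

Theorem lemma3p3 (D : spectral_duality) :
  inhabited
    (adjunction
       (functor_comp (Spec D) (fiber_inclusion (spB D) one_point))
       (global_sections D)).
Proof.
pose adj := Spec_adj D; split.
apply: (@Adjunction _ _
  (functor_comp (Spec D) (fiber_inclusion (spB D) one_point))
  (global_sections D)
  (fun (b : fiber (spB D) one_point) a h =>
    gs_factor (transpose adj h : sval b ~> iota D a))
  (fun (b : fiber (spB D) one_point) a (k : b ~> gs_obj a) =>
    untranspose adj (dir_arr (gs_lift a) ** sval k))).
- by move=> b a h; rewrite gs_factorE transposeK.
- by move=> b a k; apply: gs_factor_unique; rewrite untransposeK.
- move=> b b' a a' u v h; apply: gs_factor_unique.
  (* After composing with the lift of [a'], naturality follows from that of [adj] and the square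
     defining [gs_fmap v]. *)
  rewrite /= [RHS](transpose_natural adj (sval u) v h).
  by rewrite !compA gs_fmapE -(compA _ (dir_arr _)) gs_factorE.
Qed.
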